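(* Let $K,L,E\subset\mathbb{R}^n$ be convex bodies with $0$ in the interior of $E$, let $u:\mathbb{R}_{\geqslant0}\to\mathbb{R}$ be strictly increasing, and let $p>1$. Then for all $\lambda\in(0,1)$, \[ \mathcal{W}_u\bigl((1-\lambda)\cdot K+_p\lambda\cdot L;E\bigr)^{p/n}\geqslant\frac{1}{(n!)^{p/n}}\Bigl((1-\lambda)\mathcal{W}_u(K;E)^{p/n}+\lambda\mathcal{W}_u(L;E)^{p/n}\Bigr). \]
   Context: For convex bodies $K,E$ with $0\in\mathrm{int}\,E$, $d_E(x,K)=\min\{t\geqslant0: x\in K+tE\}$ and the generalized Wills functional is $\mathcal{W}_u(K;E)=\int_{\mathbb{R}^n}e^{-u(d_E(x,K))}\,\mathrm{d}x$. Convex body: nonempty compact convex set. For $p>1$, $1/p+1/q=1$; $K+_pL=\{(1-\mu)^{1/q}x+\mu^{1/q}y: x\in K, y\in L, \mu\in[0,1]\}$, $\lambda\cdot K=\lambda^{1/p}K$. *)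

(* Defs.v *)
From HB Require Import structures.
From mathcomp Require Import all_boot all_order all_algebra.
From mathcomp Require Import all_classical all_reals all_analysis.
Set Implicit Arguments. Unset Strict Implicit. Unset Printing Implicit Defensive.
Import Order.TTheory GRing.Theory Num.Theory.
Import numFieldNormedType.Exports.
Local Open Scope classical_set_scope.
Local Open Scope ring_scope.

Definition convex_set {R : realType} {n : nat} (K : set 'rV[R]_n) : Prop :=
  forall x y t, K x -> K y -> 0 <= t -> t <= 1 -> K ((1 - t) *: x + t *: y).

Definition convex_body {R : realType} {n : nat} (K : set 'rV[R]_n) : Prop :=
  K !=set0 /\ compact K /\ convex_set K.

(* d_E(x,K) = min { t >= 0 : x \in K + t E } (taken as an infimum; the minimum
   is attained for convex bodies). *)
Definition distE {R : realType} {n : nat} (E K : set 'rV[R]_n) (x : 'rV[R]_n) : R :=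
  inf [set t : R | 0 <= t /\
        exists2 k, K k & exists2 e, E e & x = k + t *: e].

(* Lebesgue integral over R^n of a nonnegative function, computed as the
   iterated one-dimensional Lebesgue integral (equal to the integral w.r.t.
   n-dimensional Lebesgue measure for nonnegative measurable functions, by
   Tonelli).  x = (x_1, x') is split with row_mx. *)
Fixpoint lebesgue_int {R : realType} (n : nat) : ('rV[R]_n -> \bar R) -> \bar R :=
  match n return ('rV[R]_n -> \bar R) -> \bar R with
  | 0 => fun f => f 0
  | m.+1 => fun f =>
      (\int[@lebesgue_measure R]_(t in [set: R])
          lebesgue_int (fun v : 'rV[R]_m => f (row_mx (const_mx t : 'rV[R]_1) v)))%E
  end.

Definition wills {R : realType} {n : nat} (u : R -> R) (K E : set 'rV[R]_n) : \bar R :=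
  lebesgue_int (fun x => (expR (- u (distE E K x)))%:E).

Definition conj_exp {R : realType} (p : R) : R := p / (p - 1).

Definition lp_sum {R : realType} {n : nat} (p : R) (K L : set 'rV[R]_n) : set 'rV[R]_n :=
  [set z | exists x y mu, [/\ K x, L y, 0 <= mu, mu <= 1 &
     z = ((1 - mu) `^ (conj_exp p)^-1) *: x + (mu `^ (conj_exp p)^-1) *: y]].

Definition lp_scale {R : realType} {n : nat} (p lam : R) (K : set 'rV[R]_n) : set 'rV[R]_n :=
  [set (lam `^ p^-1) *: x | x in K].

(* Main.v *)
Require Import Defs.
From HB Require Import structures.
From mathcomp Require Import all_boot all_order all_algebra.
From mathcomp Require Import all_classical all_reals all_analysis.
From mathcomp Require Import measurable_realfun ring lra.
Import Order.TTheory GRing.Theory Num.Theory.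
Import numFieldNormedType.Exports.
Local Open Scope classical_set_scope.
Local Open Scope ring_scope.

(** For [mu] in [0, 1] put [a = (1 - mu)^(1/q) (1 - lam)^(1/p)] and
[b = mu^(1/q) lam^(1/p)]; by Young's inequality [a + b <= 1], and
[a K + b L] lies in the L_p combination [M] of [K] and [L].  Since [E] is convex
and contains 0, [d(a x + b y, M) <= max (d(x, K)) (d(y, L))].  Hence the
superlevel sets [F], [G], [H] of the integrands for [K], [L], [M] at a common
level satisfy [a F + b G <= H].  For nonempty sets this already gives
[vol H >= a^n vol F + b^n vol G] without Brunn-Minkowski: for [x0] in [F] and
[y0] in [G], the part of [a F + b y0] to the left of the hyperplane
[z_1 = (a x0 + b y0)_1] and the part of [a x0 + b G] to its right are disjoint
subsets of [H], and one lets [x0_1] tend to [sup F_1] and [y0_1] to [inf G_1].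
Integrating over the levels yields [W M >= a^n W K + b^n W L].  The right-hand
side is at least [2^(1-n) (a A + b B)^n] with [A = (W K)^(1/n)] and
[B = (W L)^(1/n)], the best [mu] turns [a A + b B] into
[((1 - lam) A^p + lam B^p)^(1/p)], and [2^(n-1) <= n!]. *)

(* The library has no sigma-algebra on ['rV[R]_n]; a function on it is called
   measurable when its composition with every coordinatewise measurable map is. *)
Definition param_measurable {R : realType} {d} {T : measurableType d} {n}
    (f : T -> 'rV[R]_n -> \bar R) :=
  forall d' (T' : measurableType d') (g : T' -> T) (X : T' -> 'rV[R]_n),
    measurable_fun setT g ->
    (forall i, measurable_fun setT (fun y => X y 0 i)) ->
    measurable_fun setT (fun y => f (g y) (X y)).

Definition rv_measurable {R : realType} {n} (f : 'rV[R]_n -> \bar R) :=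
  forall d' (T' : measurableType d') (X : T' -> 'rV[R]_n),
    (forall i, measurable_fun setT (fun y => X y 0 i)) ->
    measurable_fun setT (fun y => f (X y)).

(** * Measurability, Tonelli and affine substitution for iterated integrals *)

Section Measurability.
Context {R : realType}.
Local Notation mu := (@lebesgue_measure R).
Local Notation hcons t v := (row_mx (const_mx t : 'rV[R]_1) v).

Lemma rv_measurable_section {d} {T : measurableType d} {n} (f : T -> 'rV[R]_n -> \bar R) x :
  param_measurable f -> rv_measurable (f x).
Proof. by move=> mf d' T' X mX; apply: mf. Qed.

Lemma measurable_hcons {d} {T : measurableType d} {n} (s : T -> R) (X : T -> 'rV[R]_n) i :
  measurable_fun setT s -> (forall i, measurable_fun setT (fun y => X y 0 i)) ->
  measurable_fun setT (fun y => (hcons (s y) (X y) : 'rV[R]_n.+1) 0 i).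
Proof.
move=> ms mX.
rewrite (_ : (fun y => _) = fun y => match fintype.split (i : 'I_(1 + n)) with
    inl _ => s y | inr j => X y 0 j end); last first.
  by apply/funext => y; rewrite mxE; case: fintype.splitP => // j; rewrite mxE.
by case: fintype.splitP => // j; exact: mX.
Qed.

(** Moving the first coordinate into the parameter is what lets inductions on the dimension pass
    under the outer integral. *)
Lemma param_measurable_hcons {d} {T : measurableType d} {n}
    (f : T -> 'rV[R]_n.+1 -> \bar R) :
  param_measurable f ->
  param_measurable (fun (xt : T * measurableTypeR R) (v : 'rV[R]_n) => f xt.1 (hcons xt.2 v)).
Proof.
move=> mf d' T' g X mg mX.
apply: (mf _ _ (fst \o g) (fun y => hcons (g y).2 (X y))).
  exact: measurableT_comp.
move=> i; apply: (measurable_hcons (snd \o g)) => //.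
exact: measurableT_comp.
Qed.

Lemma lebesgue_int_ge0 {n} (f : 'rV[R]_n -> \bar R) :
  (forall v, 0 <= f v)%E -> (0 <= lebesgue_int f)%E.
Proof.
elim: n f => [|n IH] f f0 /=; first exact: f0.
by apply: integral_ge0 => t _; apply: IH.
Qed.

(** Induction on [n] for all parameter spaces at once: the outer variable joins the parameter, the
    inner integral is measurable in the pair, and integrating out one factor of a product keeps
    measurability. *)
Lemma measurable_lebesgue_int {n d} {T : measurableType d} (f : T -> 'rV[R]_n -> \bar R) :
  (forall x v, 0 <= f x v)%E -> param_measurable f ->
  measurable_fun setT (fun x => lebesgue_int (f x)).
Proof.
elim: n d T f => [|n IH] d T f f0 mf /=.
  by apply: (mf _ _ id (fun=> 0)).
apply: (measurable_fun_fubini_tonelli_F (m2 := mu)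
  (fun xt => lebesgue_int (fun v => f xt.1 (hcons xt.2 v)))).
- apply: (IH _ _ (fun (xt : T * measurableTypeR R) (v : 'rV[R]_n) => f xt.1 (hcons xt.2 v))) => //.
  exact: param_measurable_hcons.
- by move=> xt; apply: lebesgue_int_ge0.
Qed.

Lemma rv_measurable_hcons {n} (f : 'rV[R]_n.+1 -> \bar R) :
  rv_measurable f ->
  param_measurable (fun (t : measurableTypeR R) (v : 'rV[R]_n) => f (hcons t v)).
Proof. by move=> mf d' T' g X mg mX; apply: mf => i; apply: measurable_hcons. Qed.

Lemma rv_measurable_hconsl {n} (f : 'rV[R]_n.+1 -> \bar R) t :
  rv_measurable f -> rv_measurable (fun v : 'rV[R]_n => f (hcons t v)).
Proof.
move=> /rv_measurable_hcons; exact: (@rv_measurable_section _ (measurableTypeR R)).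
Qed.

Lemma measurable_lebesgue_int_hcons {n} (f : 'rV[R]_n.+1 -> \bar R) :
  (forall v, 0 <= f v)%E -> rv_measurable f ->
  measurable_fun setT (fun t : measurableTypeR R => lebesgue_int (fun v : 'rV[R]_n => f (hcons t v))).
Proof. by move=> f0 mf; apply: measurable_lebesgue_int => //; exact: rv_measurable_hcons. Qed.

Lemma le_lebesgue_int {n} (f g : 'rV[R]_n -> \bar R) :
  rv_measurable f -> rv_measurable g -> (forall v, 0 <= f v)%E ->
  (forall v, f v <= g v)%E -> (lebesgue_int f <= lebesgue_int g)%E.
Proof.
elim: n f g => [|n IH] f g mf mg f0 fg /=; first exact: fg.
have g0 v : (0 <= g v)%E by exact: le_trans (fg v).
apply: ge0_le_integral => //.
- by move=> t _; exact: lebesgue_int_ge0.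
- exact: measurable_lebesgue_int_hcons.
- exact: measurable_lebesgue_int_hcons.
by move=> t _; apply: IH => //; exact: rv_measurable_hconsl.
Qed.

Lemma lebesgue_intD {n} (f g : 'rV[R]_n -> \bar R) :
  rv_measurable f -> rv_measurable g -> (forall v, 0 <= f v)%E -> (forall v, 0 <= g v)%E ->
  lebesgue_int (fun v => f v + g v)%E = (lebesgue_int f + lebesgue_int g)%E.
Proof.
elim: n f g => [//|n IH] f g mf mg f0 g0 /=.
rewrite -ge0_integralD//.
- by apply: eq_integral => t _; apply: IH => //; exact: rv_measurable_hconsl.
- by move=> t _; exact: lebesgue_int_ge0.
- exact: measurable_lebesgue_int_hcons.
- by move=> t _; exact: lebesgue_int_ge0.
- exact: measurable_lebesgue_int_hcons.
Qed.

(** The integral against [m] is exchanged with the outermost coordinate integral; for each fixed [t]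
    the induction hypothesis exchanges it with the others. *)
Lemma lebesgue_int_tonelli {n d} {T : measurableType d}
    (m : {sigma_finite_measure set T -> \bar R}) (f : T -> 'rV[R]_n -> \bar R) :
  (forall x v, 0 <= f x v)%E -> param_measurable f ->
  (\int[m]_x lebesgue_int (f x) = lebesgue_int (fun v => \int[m]_x f x v))%E.
Proof.
elim: n f => [//|n IH] f f0 mf /=.
rewrite (fubini_tonelli (m1 := m) (m2 := mu)
   (fun xt => lebesgue_int (fun v => f xt.1 (hcons xt.2 v))))/=.
- apply: eq_integral => t _; apply: IH => //.
  move=> d' T' g X mg mX; apply: (mf _ _ g (fun y => hcons t (X y))) => // i.
  exact: measurable_hcons.
- apply: (measurable_lebesgue_int (fun (xt : T * measurableTypeR R) (v : 'rV[R]_n) => f xt.1 (hcons xt.2 v))) => //.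
  exact: param_measurable_hcons.
- by move=> xt; apply: lebesgue_int_ge0.
Qed.

Lemma measurable_affine (a c : R) :
  measurable_fun [set: measurableTypeR R] (fun t : R => a * t + c : measurableTypeR R).
Proof.
by apply: measurable_funD => //; apply: measurable_funM => //; exact: measurable_id.
Qed.

(** Both sides agree on the intervals []x, y]], and this determines Lebesgue measure. *)
Lemma lebesgue_measure_affine (a c : R) (A : set R) (a0 : 0 < a) : measurable A ->
  mu A = mscale (NngNum (ltW a0))
    (measure_function_pushforward__canonical__measure_function_Measure mu
      (measurable_affine a c)) A.
Proof.
move=> mA; apply: lebesgue_measure_unique => // _ [[x y]] _ <-.
rewrite [RHS](_ : _ = a%:E * mu ((fun t : R => a * t + c)%R @^-1` `]x, y]))%E//.
rewrite [X in (a%:E * _ X)%E](_ : _ = [set` `](x - c) / a, (y - c) / a]]); last first.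
  by apply/seteqP; split => t /=; rewrite !in_itv/= ltr_pdivrMr// ler_pdivlMr//
    ltrBlDr lerBrDr (mulrC t).
rewrite !lebesgue_measure_itv/= !lte_fin ltr_pM2r ?invr_gt0// ltrD2r.
case: ifP => _; last by rewrite mule0.
by rewrite -!EFinB -EFinM; congr (_%:E); field; rewrite gt_eqF.
Qed.

Lemma integral_affine (a c : R) (f : R -> \bar R) : 0 < a ->
  measurable_fun [set: measurableTypeR R] f -> (forall t, 0 <= f t)%E ->
  (a%:E * \int[mu]_t f (a * t + c)%R = \int[mu]_t f t)%E.
Proof.
move=> a0 mf f0.
rewrite [RHS](eq_measure_integral (mscale (NngNum (ltW a0))
    (measure_function_pushforward__canonical__measure_function_Measure mu
      (measurable_affine a c)))); last by move=> A mA _; exact: lebesgue_measure_affine.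
rewrite ge0_integral_mscale//= ge0_integral_pushforward//=.
exact: measurable_affine.
Qed.

Lemma hcons_eq {n} (c : 'rV[R]_n.+1) : c = hcons (c 0 0) (rsubmx (c : 'rV_(1 + n))).
Proof.
rewrite -[LHS](@hsubmxK _ 1 1 n) (_ : lsubmx _ = const_mx (c 0 0))//.
by apply/matrixP => i j; rewrite !mxE !ord1; congr (c _ _); apply/val_inj.
Qed.

Lemma hcons_affine {n} (a t : R) (v : 'rV[R]_n) (c : 'rV[R]_n.+1) :
  a *: hcons t v + c = hcons (a * t + c 0 0) (a *: v + rsubmx (c : 'rV_(1 + n))).
Proof.
rewrite {1}(hcons_eq c) [LHS](_ : _ = (a *: hcons t v : 'rV_(1 + n)) +
  hcons (c 0 0) (rsubmx (c : 'rV_(1 + n))))// scale_row_mx add_row_mx.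
by congr (row_mx _ _); apply/matrixP => i j; rewrite !mxE.
Qed.

Lemma rv_measurable_affine {n} (a : R) (c : 'rV[R]_n) (f : 'rV[R]_n -> \bar R) :
  rv_measurable f -> rv_measurable (fun v => f (a *: v + c)).
Proof.
move=> mf d T X mX; apply: mf => i; under eq_fun do rewrite !mxE.
by apply: measurable_funD => //; apply: measurable_funM.
Qed.

(** The substitution is made coordinate by coordinate, each contributing one factor [a]. *)
Lemma lebesgue_int_affine {n} (a : R) (c : 'rV[R]_n) (f : 'rV[R]_n -> \bar R) : 0 < a ->
  rv_measurable f -> (forall v, 0 <= f v)%E ->
  ((a ^+ n)%:E * lebesgue_int (fun v => f (a *: v + c)%R) = lebesgue_int f)%E.
Proof.
move=> a0; elim: n c f => [|n IH] c f mf f0.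
  rewrite expr0 mul1e /=; congr f; exact: thinmx0.
rewrite [RHS]/=.
have mF := measurable_lebesgue_int_hcons _ f0 mf.
rewrite -(integral_affine _ (c 0 0) _ a0 mF); last by move=> t; exact: lebesgue_int_ge0.
rewrite exprS EFinM -muleA; congr (_ * _)%E.
rewrite /= -ge0_integralZl//; last 3 first.
- apply: (measurable_lebesgue_int_hcons (fun v => f (a *: v + c))) => //.
  exact: rv_measurable_affine.
- by move=> t _; exact: lebesgue_int_ge0.
- by rewrite lee_fin exprn_ge0// ltW.
apply: eq_integral => t _.
rewrite -(IH (rsubmx (c : 'rV_(1 + n))) _ (rv_measurable_hconsl _ _ mf))//.
congr (_ * _)%E; congr lebesgue_int; apply/funext => v; congr f.
exact: hcons_affine.
Qed.
End Measurability.

(** * Bounding integrals through half-lines *)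

Section HalfLines.
Context {R : realType}.
Local Notation mu := (@lebesgue_measure R).

(** If [S] is bounded above, the half-lines end at [sup S - 1 / (k + 1)] and can miss only the point
    [c = sup S] of [S]. Otherwise they end at [k] and cover the line, and [c = 0] is a dummy
    value. *)
Lemma half_lines_exhaust (S : set R) : S !=set0 ->
  exists c (B : nat -> set R), [/\ nondecreasing_seq B, forall k, measurable (B k),
    forall k, exists2 t, S t & B k `<=` `]-oo, t[ & S `\ c `<=` \bigcup_k B k].
Proof.
move=> S0; have [bS|nbS] := pselect (has_ubound S).
  have sS : has_sup S by split.
  exists (sup S), (fun k => `]-oo, sup S - k.+1%:R^-1[%classic); split => //.
  - move=> i j ij; apply/subsetPset => t /=; rewrite !in_itv/= => /lt_le_trans; apply.
    by rewrite lerD2l lerN2 lef_pV2 ?posrE ?ltr0Sn// ler_nat.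
  - move=> k; have k0 : 0 < (k.+1%:R : R)^-1 by rewrite invr_gt0.
    have [e Se lte] := sup_adherent k0 sS; exists e => // t /=.
    by rewrite !in_itv/= => /lt_trans; apply.
  - move=> t [St /eqP tc].
    have : t < sup S by rewrite lt_neqAle tc/=; exact: ub_le_sup.
    by move=> /ltr_add_invr[k tk]; exists k => //=; rewrite in_itv/= ltrBrDr.
exists 0, (fun k => `]-oo, k%:R[%classic); split => //.
- move=> i j ij; apply/subsetPset => t /=; rewrite !in_itv/= => /lt_le_trans; apply.
  by rewrite ler_nat.
- move=> k; apply: contrapT => H; apply: nbS; exists k%:R => t St.
  rewrite leNgt; apply/negP => kt; apply: H; exists t => // s /=.
  by rewrite !in_itv/= => /lt_trans; apply.
- move=> t _; exists (Num.truncn t).+1 => //=; rewrite in_itv/=; exact: truncnS_gt.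
Qed.

(** Monotone convergence along [B]; the excluded point [c] has measure zero. *)
Lemma integral_le_exhaust (f : R -> \bar R) (S : set R) c (B : nat -> set R) (C : \bar R) :
  measurable_fun [set: measurableTypeR R] f -> (forall t, 0 <= f t)%E ->
  (forall t, ~ S t -> f t = 0%E) -> nondecreasing_seq B -> (forall k, measurable (B k)) ->
  S `\ c `<=` \bigcup_k B k -> (forall k, \int[mu]_(t in B k) f t <= C)%E ->
  (\int[mu]_t f t <= C)%E.
Proof.
move=> mf f0 fS ndB mB SB fC.
have mU : measurable (\bigcup_k B k) by exact: bigcupT_measurable.
have mD : measurable ([set: R] `\ c) by exact: measurableD.
apply: (@le_trans _ _ (\int[mu]_(t in \bigcup_k B k) f t)%E); last first.
  have cv : (\int[mu]_(t in B k) f t @[k --> \oo] --> \int[mu]_(t in \bigcup_k B k) f t)%E.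
    apply: ge0_nondecreasing_set_cvg_integral => // k.
    exact: measurable_funS mf.
  by apply: cvge_le cv; exact: nearW.
rewrite -(@integral_setD1 R f c setT) //; last exact: measurable_funS mf.
rewrite [leLHS]integral_mkcond [leRHS]integral_mkcond.
apply: ge0_le_integral => //.
- by move=> t _; exact: erestrict_ge0.
- by apply/(measurable_restrictT f) => //; exact: measurable_funS mf.
- by apply/(measurable_restrictT f) => //; exact: measurable_funS mf.
move=> t _; rewrite !patchE; case: ifPn; last first.
  by move=> _; case: ifPn.
rewrite inE /= => -[_ tc]; case: ifPn => // /negP; rewrite inE => tU.
by rewrite fS// => St; apply/tU/SB.
Qed.

(** This replaces the limit of [s] towards [sup S]: a bound uniform in [s] passes to the full
    integral, whether or not the supremum is finite or attained. *)
Lemma integral_le_half_lines (f : R -> \bar R) (S : set R) (C : \bar R) :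
  measurable_fun [set: measurableTypeR R] f -> (forall t, 0 <= f t)%E ->
  S !=set0 -> (forall t, ~ S t -> f t = 0%E) ->
  (forall s, S s -> \int[mu]_(t in `]-oo, s[) f t <= C)%E ->
  (\int[mu]_t f t <= C)%E.
Proof.
move=> mf f0 S0 fS fC.
have [c [B [ndB mB BS SB]]] := half_lines_exhaust _ S0.
apply: (integral_le_exhaust _ _ _ _ _ mf f0 fS ndB mB SB) => k.
have [t St Bt] := BS k; apply: le_trans (fC _ St).
apply: ge0_subset_integral => //; first exact: mB.
exact: measurable_funS mf.
Qed.

Lemma integral_opp (f : R -> \bar R) :
  measurable_fun [set: measurableTypeR R] f -> (forall t, 0 <= f t)%E ->
  (\int[mu]_t f (- t)%R = \int[mu]_t f t)%E.
Proof.
move=> mf f0; rewrite -(@ge0_integral_pushforward _ _ (measurableTypeR R) (measurableTypeR R) R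
  (-%R : R -> R) _ mu setT)//.
by apply: eq_measure_integral => //= A mA _; exact: lebesgue_measureN.
Qed.

(** The reflection [t -> - t] turns right half-lines into left ones. *)
Lemma integral_le_half_lines_opp (f : R -> \bar R) (S : set R) (C : \bar R) :
  measurable_fun [set: measurableTypeR R] f -> (forall t, 0 <= f t)%E ->
  S !=set0 -> (forall t, ~ S t -> f t = 0%E) ->
  (forall s, S s -> \int[mu]_(t in `]s, +oo[) f t <= C)%E ->
  (\int[mu]_t f t <= C)%E.
Proof.
move=> mf f0 [s0 Ss0] fS fC; rewrite -integral_opp//.
apply: (integral_le_half_lines (fun t => f (- t)) [set s | S (- s)]) => //.
- have : measurable_fun setT (f \o (-%R : measurableTypeR R -> measurableTypeR R)).
    by apply: measurableT_comp => //; exact: oppr_measurable.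
  by [].


- by exists (- s0); rewrite /= opprK.
- by move=> t /= St; exact: fS.
move=> s /= Ss; apply: le_trans (fC _ Ss).
rewrite integral_mkcond [leRHS]integral_mkcond -[leRHS]integral_opp.
- rewrite le_eqVlt; apply/orP; left; apply/eqP; apply: eq_integral => t _.
  by rewrite !patchE !mem_setE !in_itv/= andbT ltrN2.
- by apply/(measurable_restrictT f) => //; exact: measurable_funS mf.
- by move=> t; exact: erestrict_ge0.
Qed.
End HalfLines.

(** * Superadditivity of volume under weighted sums of sets *)

Section Superadditivity.
Context {R : realType}.
Local Notation mu := (@lebesgue_measure R).
Local Notation hcons t v := (row_mx (const_mx t : 'rV[R]_1) v).

Lemma lebesgue_int0 n : lebesgue_int (fun _ : 'rV[R]_n => 0%E) = 0%E.
Proof.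
by elim: n => [//|n IH] /=; apply: integral0_eq => t _; exact: IH.
Qed.

Lemma hcons0 n (t : R) (v : 'rV[R]_n) : (hcons t v : 'rV[R]_n.+1) 0 0 = t.
Proof. by rewrite mxE; case: fintype.splitP => [j _|j //]; rewrite mxE. Qed.

(** The first coordinate is the outer variable of integration, so a condition on it restricts only
    the outer integral. *)
Lemma lebesgue_int_slab n (f : 'rV[R]_n.+1 -> \bar R) (I : set R) :
  lebesgue_int (fun x => f x * (\1_I (x 0 0))%:E)%E =
  (\int[mu]_(t in I) lebesgue_int (fun v : 'rV[R]_n => f (hcons t v)))%E.
Proof.
rewrite [RHS]integral_mkcond /=; apply: eq_integral => t _.
rewrite patchE; case: ifPn => tI.
  by congr lebesgue_int; apply/funext => v; rewrite hcons0 indicE tI mule1.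
rewrite -[RHS](lebesgue_int0 n); congr lebesgue_int; apply/funext => v.
by rewrite hcons0 indicE (negbTE tI) mule0.
Qed.

Lemma rv_measurable_slab n (f : 'rV[R]_n.+1 -> \bar R) (I : set R) : measurable I ->
  rv_measurable f -> rv_measurable (fun x => f x * (\1_I (x 0 0))%:E)%E.
Proof.
move=> mI mf d T X mX; apply: emeasurable_funM; first exact: mf.
apply/measurable_EFinP; apply: (measurableT_comp (measurable_indic mI)).
exact: mX.
Qed.

Definition vol {n} (A : set 'rV[R]_n) : \bar R := lebesgue_int (fun x => (\1_A x)%:E).

(** Both terms become integrals over a common variable [z], where the claim is pointwise: off [H]
    both indicators vanish, and on [H] at most one of them is 1. *)
Lemma vol_superadd_slabs n (a b : R) (F G H : set 'rV[R]_n.+1) (x0 y0 : 'rV[R]_n.+1) :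
  0 < a -> 0 < b ->
  rv_measurable (fun x => (\1_F x)%:E) -> rv_measurable (fun x => (\1_G x)%:E) ->
  rv_measurable (fun x => (\1_H x)%:E) -> F x0 -> G y0 ->
  (forall x y, F x -> G y -> H (a *: x + b *: y)) ->
  ((a ^+ n.+1)%:E * (\int[mu]_(t in `]-oo, (x0 0 0)%R[)
       lebesgue_int (fun v : 'rV[R]_n => (\1_F (hcons t v))%:E)) +
   (b ^+ n.+1)%:E * (\int[mu]_(t in `](y0 0 0)%R, +oo[)
       lebesgue_int (fun v : 'rV[R]_n => (\1_G (hcons t v))%:E)) <= vol H)%E.
Proof.
move=> a0 b0 mF mG mH Fx0 Gy0 FGH.
rewrite -(lebesgue_int_slab _ (fun x => (\1_F x)%:E)) -(lebesgue_int_slab _ (fun x => (\1_G x)%:E)).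
set f := fun x => _; set g := fun x => ((\1_G x)%:E * _)%E.
have mf : rv_measurable f by exact: rv_measurable_slab.
have mg : rv_measurable g by exact: rv_measurable_slab.
have f0 x : (0 <= f x)%E by rewrite /f -EFinM lee_fin mulr_ge0.
have g0 x : (0 <= g x)%E by rewrite /g -EFinM lee_fin mulr_ge0.
have scale (c : R) (w : 'rV[R]_n.+1) h : 0 < c -> rv_measurable h -> (forall x, 0 <= h x)%E ->
    ((c ^+ n.+1)%:E * lebesgue_int h = lebesgue_int (fun z => h (c^-1 *: z + w)%R))%E.
  move=> c0 mh h0; rewrite -(@lebesgue_int_affine _ _ c^-1 w h) ?invr_gt0//.
  by rewrite muleA -EFinM -exprMn divff ?gt_eqF// expr1n mul1e.
(* The translations are chosen so that [z = a *: x + b *: y0] in the first integrand and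
   [z = a *: x0 + b *: y] in the second. *)
rewrite (scale a (- ((b / a) *: y0)) f)// (scale b (- ((a / b) *: x0)) g)//.
rewrite -lebesgue_intD//; last 2 first.
- exact: rv_measurable_affine.
- exact: rv_measurable_affine.
apply: le_lebesgue_int => //.
- move=> d T X mX; apply: emeasurable_funD.
    exact: (@rv_measurable_affine _ _ a^-1 (- ((b / a) *: y0)) f mf).
  exact: (@rv_measurable_affine _ _ b^-1 (- ((a / b) *: x0)) g mg).
- by move=> z; exact: adde_ge0.
move=> z; rewrite /f /g -!EFinM -EFinD lee_fin.
set x := a^-1 *: z + _; set y := b^-1 *: z + _.
have zx : z = a *: x + b *: y0.
  apply/matrixP => i j; rewrite !mxE; field; by rewrite gt_eqF.
have zy : z = a *: x0 + b *: y.
  apply/matrixP => i j; rewrite !mxE; field; by rewrite gt_eqF.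
have zxH : F x -> H z by move=> Fx; rewrite zx; exact: FGH.
have zyH : G y -> H z by move=> Gy; rewrite zy; exact: FGH.
(* Disjointness: the first coordinate of [z] would lie both strictly below and strictly above that
   of [a *: x0 + b *: y0]. *)
have xy : x 0 0 < x0 0 0 -> y0 0 0 < y 0 0 -> False.
  move: zx; rewrite {1}zy; move: x y {zy zxH zyH} => x y + lx ly.
  move=> /esym/matrixP/(_ 0 0).
  rewrite !mxE; apply/eqP; by rewrite lt_eqF// ltrD// ltr_pM2l.
rewrite !indicE !mem_setE !in_itv/= andbT.
have [Hz|nHz] := pselect (H z); last first.
  have -> : (x \in F) = false by apply/negP; rewrite inE => /zxH.
  have -> : (y \in G) = false by apply/negP; rewrite inE => /zyH.
  by rewrite !mul0r addr0.
rewrite (mem_set Hz).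
have [lx|lx] := boolP (x 0 0 < x0 0 0).
  have -> : (y0 0 0 < y 0 0) = false by apply/negP => /(xy lx).
  by rewrite mulr0 addr0 mulr1 lern1 leq_b1.
rewrite mulr0 add0r -natrM lern1.
by case: (_ \in _); case: (_ < _).
Qed.

(* The first coordinates [x0 0 0] and [y0 0 0] in [vol_superadd_slabs] are sent to
   the supremum and the infimum, one after the other. *)
Lemma vol_superadd n (a b : R) (F G H : set 'rV[R]_n.+1) :
  0 < a -> 0 < b ->
  rv_measurable (fun x => (\1_F x)%:E) -> rv_measurable (fun x => (\1_G x)%:E) ->
  rv_measurable (fun x => (\1_H x)%:E) -> F !=set0 -> G !=set0 ->
  (forall x y, F x -> G y -> H (a *: x + b *: y)) ->
  ((a ^+ n.+1)%:E * vol F + (b ^+ n.+1)%:E * vol G <= vol H)%E.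
Proof.
move=> a0 b0 mF mG mH [x1 Fx1] [y1 Gy1] FGH.
have an : (0 <= (a ^+ n.+1)%:E)%E by rewrite lee_fin exprn_ge0 ?ltW.
have bn : (0 <= (b ^+ n.+1)%:E)%E by rewrite lee_fin exprn_ge0 ?ltW.
have slabs x0 y0 Fx0 Gy0 := vol_superadd_slabs _ _ _ _ _ _ x0 y0 a0 b0 mF mG mH Fx0 Gy0 FGH.
(* From here on [vol H] is finite, so summands can be moved across the inequality by subtraction. *)
have [->|VH] := eqVneq (vol H) +oo%E; first by rewrite leey.
have ind0 (A : set 'rV[R]_n.+1) x : (0 <= (\1_A x : R)%:E)%E by rewrite lee_fin.
set f := fun t : R => lebesgue_int (fun v : 'rV[R]_n => (\1_F (hcons t v))%:E) in slabs.
set g := fun t : R => lebesgue_int (fun v : 'rV[R]_n => (\1_G (hcons t v))%:E) in slabs.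
have volF : vol F = (\int[mu]_t f t)%E by [].
have volG : vol G = (\int[mu]_t g t)%E by [].
have f0 t : (0 <= f t)%E by exact: lebesgue_int_ge0.
have g0 t : (0 <= g t)%E by exact: lebesgue_int_ge0.
have mf : measurable_fun [set: measurableTypeR R] f.
  exact: (measurable_lebesgue_int_hcons (fun x => (\1_F x)%:E)).
have mg : measurable_fun [set: measurableTypeR R] g.
  exact: (measurable_lebesgue_int_hcons (fun x => (\1_G x)%:E)).
have mZ h (D : set R) c : measurable D -> measurable_fun [set: measurableTypeR R] h ->
    (forall t, 0 <= h t)%E -> (0 <= c%:E)%E ->
    (c%:E * \int[mu]_(t in D) h t = \int[mu]_(t in D) (c%:E * h t))%E.
  by move=> mD mh h0 c0; rewrite ge0_integralZl//; exact: measurable_funS mh.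
have finl (u v : \bar R) : (0 <= u -> 0 <= v -> u + v <= vol H -> v \is a fin_num)%E.
  move=> u0 v0 uv; rewrite ge0_fin_numE//; apply: (@le_lt_trans _ _ (vol H)).
    by apply: le_trans uv; rewrite leeDr.
  by rewrite ltey.
have out (A : set 'rV[R]_n.+1) (t : R) : ~ [set x 0 0 | x in A] t ->
    lebesgue_int (fun v : 'rV[R]_n => (\1_A (hcons t v))%:E) = 0%E.
  move=> nA; rewrite -[RHS](lebesgue_int0 n); congr lebesgue_int; apply/funext => v.
  rewrite indicE memNset// => Av; apply: nA; exists (hcons t v) => //.
  exact: hcons0.
(* First limit: [y0] stays fixed while the half-lines bounded by first coordinates of points of [F]
   exhaust [F]. *)
have step1 y0 : G y0 ->
    ((a ^+ n.+1)%:E * vol F + (b ^+ n.+1)%:E * (\int[mu]_(t in `](y0 0 0)%R, +oo[) g t) <= vol H)%E.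
  move=> Gy0; set Y := (_ * \int[mu]_(t in _) g t)%E.
  have Y0 : (0 <= Y)%E by rewrite mule_ge0// integral_ge0.
  have Yf : Y \is a fin_num.
    apply: finl _ Y0 (slabs _ _ Fx1 Gy0).
    by rewrite mule_ge0// integral_ge0// => t _; exact: f0.
  rewrite -leeBrDr// volF mZ//.
  apply: (integral_le_half_lines _ [set x 0 0 | x in F]).
  - exact: measurable_funeM.
  - by move=> t; rewrite mule_ge0.
  - by exists (x1 0 0), x1.
  - by move=> t /out tF; rewrite /f tF mule0.
  by move=> _ [x Fx <-]; rewrite -mZ// leeBrDr//; exact: slabs.
set X := ((a ^+ n.+1)%:E * vol F)%E.
have X0 : (0 <= X)%E by rewrite mule_ge0//; exact: lebesgue_int_ge0.
have Xf : X \is a fin_num.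
  have := step1 _ Gy1; rewrite addeC; apply: finl => //.
  by rewrite mule_ge0// integral_ge0// => t _; exact: g0.
(* Second limit: the full volume of [F] is already in place, and the right half-lines exhaust
   [G]. *)
rewrite addeC -leeBrDr// volG mZ//.
apply: (integral_le_half_lines_opp _ [set x 0 0 | x in G]).
- exact: measurable_funeM.
- by move=> t; rewrite mule_ge0.
- by exists (y1 0 0), y1.
- by move=> t /out tG; rewrite /g tG mule0.
by move=> _ [y Gy <-]; rewrite -mZ// leeBrDr// addeC; exact: step1.
Qed.
End Superadditivity.

(** * Layer-cake formula, passage from sets to functions, measurability of Lipschitz functions *)

Section Layers.
Context {R : realType}.
Local Notation mu := (@lebesgue_measure R).

Lemma param_measurable_layers n (f : 'rV[R]_n -> R) : rv_measurable (EFin \o f) ->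
  param_measurable (fun (s : measurableTypeR R) v => (\1_(`[0%R, f v[) s)%:E).
Proof.
move=> mf d T g X mg mX.
(* Membership of the level in the layer is split into a sign condition on the level and one on a
   difference, each measurable. *)
rewrite (_ : (fun y => _) = fun y => ((\1_`[0, +oo[ (g y) : R) * \1_`]0, +oo[ (f (X y) - g y))%:E).
  apply/measurable_EFinP; apply: measurable_funM.
    by apply: measurableT_comp => //; exact: measurable_indic.
  apply: measurableT_comp; first exact: measurable_indic.
  apply: measurable_funB => //.
  by apply/measurable_EFinP; exact: mf.
apply/funext => y; congr _%:E; rewrite !indicE !mem_setE !in_itv/= !andbT subr_gt0 -natrM.
by rewrite mulnb.
Qed.

(** The value [f v] is the length of [[0, f v[]; Tonelli exchanges the level and the point. *)
Lemma lebesgue_int_layers n (f : 'rV[R]_n -> R) :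
  (forall v, 0 <= f v) -> rv_measurable (EFin \o f) ->
  lebesgue_int (EFin \o f) =
  (\int[mu]_s lebesgue_int (fun v => (\1_(`[0%R, f v[) s)%:E))%E.
Proof.
move=> f0 mf; rewrite lebesgue_int_tonelli.
- congr lebesgue_int; apply/funext => v /=.
  rewrite integral_indic// setIT -[RHS]/(mu `[0%R, f v[%classic) lebesgue_measure_itv/= lte_fin.
  by case: ltP => [_|fv]; rewrite ?sube0//; congr _%:E; apply/le_anti; rewrite fv f0.
- by move=> s v; rewrite lee_fin.
exact: param_measurable_layers.
Qed.

Lemma indic_layer n (f : 'rV[R]_n -> R) s v : 0 <= s ->
  \1_(`[0%R, f v[) s = \1_[set w | s < f w] v :> R.
Proof.
move=> s0; rewrite !indicE mem_setE in_itv/= s0/=.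
by congr ((nat_of_bool _)%:R); apply/idP/idP; rewrite inE.
Qed.

Lemma rv_measurable_layer n (f : 'rV[R]_n -> R) s :
  rv_measurable (EFin \o f) -> rv_measurable (fun v => (\1_[set w | s < f w] v)%:E).
Proof.
move=> mf d T X mX.
rewrite (_ : (fun y => _) = fun y => (\1_`]s, +oo[ (f (X y)))%:E).
  apply/measurable_EFinP; apply: measurableT_comp; first exact: measurable_indic.
  by apply/measurable_EFinP; exact: mf.
apply/funext => y; rewrite !indicE; congr ((nat_of_bool _)%:R%:E).
by apply/idP/idP; rewrite !inE /= in_itv/= andbT.
Qed.

(** The common maximum [m], attained by both [f] and [g], makes their superlevel sets nonempty at
    exactly the same levels, so [vol_superadd] applies level by level. *)
Lemma lebesgue_int_superadd n (a b m : R) (f g h : 'rV[R]_n.+1 -> R) x0 y0 :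
  0 < a -> 0 < b ->
  rv_measurable (EFin \o f) -> rv_measurable (EFin \o g) -> rv_measurable (EFin \o h) ->
  (forall x, 0 <= f x <= m) -> (forall y, 0 <= g y <= m) -> (forall z, 0 <= h z) ->
  f x0 = m -> g y0 = m ->
  (forall x y, Num.min (f x) (g y) <= h (a *: x + b *: y)) ->
  ((a ^+ n.+1)%:E * lebesgue_int (EFin \o f) + (b ^+ n.+1)%:E * lebesgue_int (EFin \o g)
     <= lebesgue_int (EFin \o h))%E.
Proof.
move=> a0 b0 mf mg mh fm gm h0 fx0 gy0 fgh.
have f0 x : 0 <= f x by case/andP: (fm x).
have g0 x : 0 <= g x by case/andP: (gm x).
have an : (0 <= (a ^+ n.+1)%:E)%E by rewrite lee_fin exprn_ge0 ?ltW.
have bn : (0 <= (b ^+ n.+1)%:E)%E by rewrite lee_fin exprn_ge0 ?ltW.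
have pm (k : 'rV[R]_n.+1 -> R) : rv_measurable (EFin \o k) ->
    measurable_fun [set: measurableTypeR R] (fun s => lebesgue_int (fun v => (\1_(`[0%R, k v[) s)%:E)).
  move=> mk; apply: measurable_lebesgue_int; first by move=> *; rewrite lee_fin.
  exact: param_measurable_layers.
have L0 (k : 'rV[R]_n.+1 -> R) s : (0 <= lebesgue_int (fun v => (\1_(`[0%R, k v[) s)%:E))%E.
  by apply: lebesgue_int_ge0 => v; rewrite lee_fin.
rewrite !lebesgue_int_layers// -!ge0_integralZl//; try exact: pm.
rewrite -ge0_integralD//; last 4 first.
- by move=> s _; rewrite mule_ge0.
- by apply: measurable_funeM; exact: pm.
- by move=> s _; rewrite mule_ge0.
- by apply: measurable_funeM; exact: pm.
apply: ge0_le_integral => //.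
- by move=> s _; rewrite adde_ge0// mule_ge0.
- by apply: emeasurable_funD; apply: measurable_funeM; exact: pm.
- exact: pm.
move=> s _.
have zero (k : 'rV[R]_n.+1 -> R) : (forall v, ~~ (0 <= s < k v)) ->
    lebesgue_int (fun v => (\1_(`[0%R, k v[) s)%:E) = 0%E.
  move=> ks; rewrite -[RHS](lebesgue_int0 n.+1); congr lebesgue_int; apply/funext => v.
  by rewrite indicE mem_setE in_itv/= (negbTE (ks v)).
have [s0|s0] := leP 0 s; last first.
  by rewrite !zero ?mule0 ?adde0// => v; rewrite leNgt s0.
(* At levels [s >= m] the left-hand side vanishes; below [m], the points [x0] and [y0] witness
   nonemptiness. *)
have [sm|sm] := ltP s m; last first.
  rewrite (zero f) ?(zero g) ?mule0 ?adde0//.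
    by move=> v; rewrite negb_and -!leNgt; apply/orP; right; rewrite (le_trans _ sm)//; case/andP: (gm v).
  by move=> v; rewrite negb_and -!leNgt; apply/orP; right; rewrite (le_trans _ sm)//; case/andP: (fm v).
have lay (k : 'rV[R]_n.+1 -> R) : (fun v => (\1_(`[0%R, k v[) s : R)%:E) =
    fun v => (\1_[set w | s < k w] v : R)%:E.
  by apply/funext => v; rewrite (indic_layer _ k).
rewrite !lay; apply: vol_superadd => //; try exact: rv_measurable_layer.
- by exists x0; rewrite /= fx0.
- by exists y0; rewrite /= gy0.
move=> x y /= sx sy; apply: lt_le_trans (fgh x y).
by rewrite lt_min sx.
Qed.

(* [f] is the infimum of the functions [C |x - q|_1 + f q] over the rational [q]. *)
Lemma rv_measurable_lipschitz n (C : R) (f : 'rV[R]_n -> R) :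
  0 < C -> (forall x y, f x <= f y + C * \sum_i `|x 0 i - y 0 i|) ->
  rv_measurable (EFin \o f).
Proof.
move=> C0 fC d T X mX; apply/measurable_EFinP.
apply: (measurability (@RGenInftyO.G R)) => [|/= _ [_ [r ->] <-]].
  exact: RGenInftyO.measurableE.
rewrite setTI.
pose rq (q : 'rV[rat]_n) : 'rV[R]_n := \row_i ratr (q 0 i).
rewrite (_ : _ @^-1` _ = \bigcup_(q in [set: 'rV[rat]_n])
    (fun y => f (rq q) + C * \sum_i `|X y 0 i - rq q 0 i|) @^-1` `]-oo, r[); last first.
  apply/seteqP; split => y /=; rewrite in_itv/=; last first.
    by move=> [q _ /=]; rewrite in_itv/=; apply: le_lt_trans; exact: fC.
  (* A rational point within [e] in each coordinate costs at most [2 * C * n * e], which is less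
     than [r - f (X y)]. The factor [n.+1] gives strictness and also covers [n = 0]. *)
  move=> fr; pose e := (r - f (X y)) / (2 * C * n.+1%:R).
  have e0 : 0 < e by rewrite divr_gt0 ?subr_gt0// !mulr_gt0.
  have /choice[q qP] i : exists q : rat, `|X y 0 i - ratr q| <= e.
    have /rat_in_itvoo[q] : X y 0 i - e < X y 0 i + e by rewrite -subr_gt0; lra.
    by rewrite in_itv/= => /andP[q1 q2]; exists q; rewrite ler_norml; apply/andP; split; lra.
  exists (\row_i q i) => //=; rewrite in_itv/=.
  set S := \sum_i _.
  have SE : S <= n%:R * e.
    rewrite mulr_natl -[X in _ *+ X](card_ord n) -sumr_const.
    by apply: ler_sum => i _; rewrite !mxE.
  have := fC (rq (\row_i q i)) (X y).
  under eq_bigr do rewrite distrC.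
  rewrite -/S => fq.
  have : 2 * C * S < r - f (X y).
    apply: (@le_lt_trans _ _ (2 * C * (n%:R * e))).
      by rewrite ler_pM2l// mulr_gt0.
    rewrite /e; have n0 : (0 : R) < n.+1%:R by [].
    rewrite [ltLHS](_ : _ = (r - f (X y)) * (n%:R / n.+1%:R)); last first.
      by field; rewrite (gt_eqF C0) gt_eqF.
    rewrite gtr_pMr ?subr_gt0// ltr_pdivrMr// mul1r ltr_nat//.
  by lra.
apply: countable_bigcupT_measurable; first exact: countableP.
move=> q; rewrite -[_ @^-1` _]setTI.
suff : measurable_fun setT (fun y => f (rq q) + C * \sum_i `|X y 0 i - rq q 0 i|).
  by apply => //; exact: measurable_itv.
apply: measurable_funD => //; apply: measurable_funM => //.
apply: measurable_sum => i; apply: measurableT_comp => //.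
by apply: measurable_funB.
Qed.
End Layers.

(** * The distance relative to [E] *)

(* [convex_set] alone would denote the notion of MathComp-Analysis. *)
Section Distance.
Context {R : realType} {n : nat}.
Implicit Types (K L M E : set 'rV[R]_n) (x y : 'rV[R]_n).

Let radii E K x := [set t : R | 0 <= t /\ exists2 k, K k & exists2 e, E e & x = k + t *: e].

(** Convexity of [E] enters the distance estimates here: radii add when points are added. If
    [s + t = 0], both scalars vanish and any point of [E] serves. *)
Lemma convex_cone E (s t : R) e e' : Defs.convex_set E -> 0 <= s -> 0 <= t -> E e -> E e' ->
  exists2 e'', E e'' & s *: e + t *: e' = (s + t) *: e''.
Proof.
move=> cE s0 t0 Ee Ee'; have [st0|st0] := eqVneq (s + t) 0.
  have : s = 0 /\ t = 0 by split; lra.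
  by case=> -> ->; exists e => //; rewrite addr0 !scale0r addr0.
have stp : 0 < s + t by rewrite lt_neqAle eq_sym st0 addr_ge0.
exists ((1 - t / (s + t)) *: e + (t / (s + t)) *: e').
  by apply: cE => //; rewrite ?divr_ge0 ?ler_pdivrMr ?(ltW stp)//; lra.
by apply/matrixP => i j; rewrite !mxE; field.
Qed.

(** [E] contains a ball of radius [d] for the maximum norm, which the sum of absolute values
    dominates; hence [C = 1 / d]. *)
Lemma interior0_cone E : interior E 0 -> exists2 C : R, 0 < C &
  forall (v : 'rV[R]_n) (t : R), \sum_i `|v 0 i| * C < t -> exists2 e, E e & v = t *: e.
Proof.
rewrite /interior /= => /nbhs_ballP[d /= d0 dE]; exists d^-1; first by rewrite invr_gt0.
move=> v t vt; have t0 : 0 < t.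
  by apply: le_lt_trans vt; rewrite sumr_ge0// => i _; rewrite mulr_ge0// invr_ge0 ltW.
exists (t^-1 *: v); last by rewrite scalerA divff ?scale1r// gt_eqF.
apply: dE; split => // i j; rewrite /ball/= !mxE ord1 sub0r normrN normrM.
rewrite gtr0_norm ?invr_gt0// mulrC ltr_pdivrMr// -ltr_pdivrMl// mulrC.
apply: le_lt_trans vt; rewrite (bigD1 j)//= lerDl sumr_ge0// => k _.
by rewrite mulr_ge0// invr_ge0 ltW.
Qed.

(** Ensures that the [inf] in [distE] is a true infimum and not the default value on the empty
    set. *)
Lemma radii_neq0 E K x : interior E 0 -> K !=set0 -> radii E K x !=set0.
Proof.
move=> /interior0_cone[C C0 cE] [k Kk].
have := cE (x - k) (\sum_i `|(x - k) 0 i| * C + 1); rewrite ltrDl ltr01 => /(_ isT)[e Ee xk].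
exists (\sum_i `|(x - k) 0 i| * C + 1); split; last by exists k => //; exists e => //; rewrite -xk addrC subrK.
by rewrite addr_ge0// sumr_ge0// => i _; rewrite mulr_ge0// ltW.
Qed.

Lemma distE_ge0 E K x : interior E 0 -> K !=set0 -> 0 <= distE E K x.
Proof. by move=> E0 K0; apply: lb_le_inf; [exact: radii_neq0|move=> t []]. Qed.

Lemma distE_le E K x t : radii E K x t -> distE E K x <= t.
Proof. by move=> xt; apply: ge_inf => //; exists 0 => s []. Qed.

Lemma distE_mem E K x : interior E 0 -> K x -> distE E K x = 0.
Proof.
move=> E0 Kx; apply/le_anti; rewrite distE_ge0 ?andbT//; last by exists x.
apply: distE_le; split => //; exists x => //; exists 0; first exact: nbhs_singleton.
by rewrite scaler0 addr0.
Qed.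

Lemma distE_lt E K x r : interior E 0 -> K !=set0 -> distE E K x < r ->
  exists2 t, radii E K x t & t < r.
Proof. by move=> E0 K0; apply: inf_lt; exact: radii_neq0. Qed.

(** Nearly optimal radii [s] and [t] for [x] and [y] give the admissible radius [a * s + b * t] for
    the combination, by [convex_cone]. Since [a + b <= 1], it is at most the larger distance plus
    [e]. *)
Lemma distE_combination E K L M (a b : R) x y :
  Defs.convex_set E -> interior E 0 -> K !=set0 -> L !=set0 ->
  0 <= a -> 0 <= b -> a + b <= 1 ->
  (forall x y, K x -> L y -> M (a *: x + b *: y)) ->
  distE E M (a *: x + b *: y) <= Num.max (distE E K x) (distE E L y).
Proof.
move=> cE E0 K0 L0 a0 b0 ab KLM; apply/ler_addgt0Pr => e e0.
set D := Num.max _ _.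
have [s [s0 [k Kk [e1 Ee1 xE]]] sD] : exists2 t, radii E K x t & t < D + e.
  by apply: distE_lt => //; rewrite (le_lt_trans (y := D))// ?ltrDl// le_max lexx.
have [t [t0 [l Ll [e2 Ee2 yE]]] tD] : exists2 t, radii E L y t & t < D + e.
  by apply: distE_lt => //; rewrite (le_lt_trans (y := D))// ?ltrDl// le_max lexx orbT.
have [e3 Ee3 e3E] := convex_cone E _ _ _ _ cE (mulr_ge0 a0 s0) (mulr_ge0 b0 t0) Ee1 Ee2.
have De : 0 <= D + e by apply: le_trans (ltW sD).
apply: (@le_trans _ _ (a * s + b * t)).
  apply: distE_le; split; first by rewrite addr_ge0// mulr_ge0.
  exists (a *: k + b *: l); first exact: KLM.
  exists e3 => //; rewrite -e3E xE yE.
  by apply/matrixP => i j; rewrite !mxE; ring.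
apply: (@le_trans _ _ (a * (D + e) + b * (D + e))).
  by apply: lerD; apply: ler_wpM2l => //; exact: ltW.
by rewrite -mulrDl ler_piMl.
Qed.

(** Going from [y] to [x] adds a radius that carries [x - y]. One half of [e] pays for
    near-optimality, the other for the strict inequality in [interior0_cone]. *)
Lemma distE_lipschitz E K : Defs.convex_set E -> interior E 0 -> K !=set0 ->
  exists2 C : R, 0 < C &
    forall x y, distE E K x <= distE E K y + C * \sum_i `|x 0 i - y 0 i|.
Proof.
move=> cE E0 K0; have [C C0 coneE] := interior0_cone _ E0; exists C => // x y.
apply/ler_addgt0Pr => e e0.
have e20 : 0 < e / 2 by rewrite divr_gt0.
have [t [t0 [k Kk [e1 Ee1 yE]]] tD] : exists2 t, radii E K y t & t < distE E K y + e / 2.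
  by apply: distE_lt => //; rewrite ltrDl.
set S := \sum_i `|x 0 i - y 0 i|.
have S0 : 0 <= S by exact: sumr_ge0.
have CS : 0 <= C * S + e / 2 by rewrite addr_ge0 ?mulr_ge0// ltW.
have [e2 Ee2 xyE] : exists2 e', E e' & x - y = (C * S + e / 2) *: e'.
  apply: coneE; rewrite -mulr_suml (_ : \sum_i _ = S) 1?mulrC ?ltrDl//.
  by apply: eq_bigr => i _; rewrite !mxE.
have [e3 Ee3 e3E] := convex_cone E _ _ _ _ cE t0 CS Ee1 Ee2.
apply: (@le_trans _ _ (t + (C * S + e / 2))); last by lra.
apply: distE_le; split; first by rewrite addr_ge0.
exists k => //; exists e3 => //; rewrite -e3E addrA -yE -xyE.
by rewrite addrC subrK.
Qed.
End Distance.

(** * Superadditivity of the Wills functional *)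

Section Wills.
Context {R : realType}.

(** Serves the degenerate case where one of the two coefficients is zero. *)
Lemma lebesgue_int_scale_le n (a : R) w (f h : 'rV[R]_n -> \bar R) : 0 < a ->
  rv_measurable f -> rv_measurable h -> (forall x, 0 <= f x)%E -> (forall x, 0 <= h x)%E ->
  (forall x, f x <= h (a *: x + w)%R)%E ->
  ((a ^+ n)%:E * lebesgue_int f <= lebesgue_int h)%E.
Proof.
move=> a0 mf mh f0 h0 fh; rewrite -(@lebesgue_int_affine _ _ a w h)//.
apply: lee_wpmul2l; first by rewrite lee_fin exprn_ge0 ?ltW.
by apply: le_lebesgue_int => //; exact: rv_measurable_affine.
Qed.

Variable u : R -> R.
Hypothesis u_incr : forall s t : R, 0 <= s -> s < t -> u s < u t.

Let le_u s t : 0 <= s -> s <= t -> u s <= u t.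
Proof. by move=> s0; rewrite le_eqVlt => /predU1P[->//|/(u_incr _ _ s0)/ltW]. Qed.

Lemma rv_measurable_wills n (K E : set 'rV[R]_n) :
  Defs.convex_set E -> interior E 0 -> K !=set0 ->
  rv_measurable (fun x => (expR (- u (distE E K x)))%:E).
Proof.
move=> cE E0 K0 d T X mX; apply/measurable_EFinP.
have [C C0 lip] := distE_lipschitz E K cE E0 K0.
(* Monotonicity of [u] is known only on nonnegative reals, so it is extended by the constant [u 0];
   a monotone function is measurable. *)
pose phi t := expR (- u (Num.max 0 t)).
rewrite (_ : (fun y => _) = phi \o (fun y => distE E K (X y))); last first.
  by apply/funext => y; rewrite /phi /= max_r// distE_ge0.
apply: measurableT_comp.
  apply: nonincreasing_measurable => // s t st.
  have m0 : 0 <= Num.max 0 s by rewrite le_max lexx.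
  have mst : Num.max 0 s <= Num.max 0 t by rewrite ge_max !le_max lexx st orbT.
  by rewrite /phi ler_expR lerN2; exact: le_u.
apply/measurable_EFinP; exact: (rv_measurable_lipschitz _ _ _ C0 lip _ _ X mX).
Qed.

Lemma wills_ge0 n (K E : set 'rV[R]_n) : (0 <= wills u K E)%E.
Proof. by apply: lebesgue_int_ge0 => x; rewrite lee_fin expR_ge0. Qed.

(** Since [exp(-u)] is decreasing, the maximum of distances becomes a minimum of integrands. Both
    integrands have maximum [exp(-u(0))], attained on [K] and on [L]. *)
Lemma wills_superadd n (K L M E : set 'rV[R]_n.+1) (a b : R) :
  Defs.convex_set E -> interior E 0 -> K !=set0 -> L !=set0 ->
  0 <= a -> 0 <= b -> a + b <= 1 ->
  (forall x y, K x -> L y -> M (a *: x + b *: y)) ->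
  ((a ^+ n.+1)%:E * wills u K E + (b ^+ n.+1)%:E * wills u L E <= wills u M E)%E.
Proof.
move=> cE E0 K0 L0 a0 b0 ab KLM.
have M0 : M !=set0.
  by have [x Kx] := K0; have [y Ly] := L0; exists (a *: x + b *: y); exact: KLM.
have [x0 Kx0] := K0; have [y0 Ly0] := L0.
have mK := rv_measurable_wills _ K E cE E0 K0.
have mL := rv_measurable_wills _ L E cE E0 L0.
have mM := rv_measurable_wills _ M E cE E0 M0.
have bnd (N : set 'rV[R]_n.+1) x : N !=set0 -> 0 <= expR (- u (distE E N x)) <= expR (- u 0).
  by move=> N0; rewrite expR_ge0 ler_expR lerN2 le_u// distE_ge0.
have KLM_le x y : Num.min (expR (- u (distE E K x))) (expR (- u (distE E L y))) <=
    expR (- u (distE E M (a *: x + b *: y))).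
  have := distE_combination E K L M a b x y cE E0 K0 L0 a0 b0 ab KLM.
  rewrite ge_min le_max => /orP[]h; apply/orP; [left|right];
    by rewrite ler_expR lerN2 le_u// distE_ge0.
have ge0 (N : set 'rV[R]_n.+1) x : (0 <= (expR (- u (distE E N x)))%:E)%E.
  by rewrite lee_fin expR_ge0.
move: a0; rewrite le_eqVlt => /predU1P[aE|a0].
  rewrite -aE expr0n/= mul0e add0e.
  move: b0; rewrite le_eqVlt => /predU1P[<-|b0]; first by rewrite expr0n/= mul0e wills_ge0.
  (* With [x] frozen at [x0] in [K], the integrand of [K] is maximal, so the minimum is the
     integrand of [L]. *)
  apply: (lebesgue_int_scale_le _ _ (a *: x0)) => // y; rewrite lee_fin.
  have := KLM_le x0 y; rewrite distE_mem// min_r; last by case/andP: (bnd L y L0).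
  by rewrite addrC.
move: b0; rewrite le_eqVlt => /predU1P[bE|b0].
  rewrite -bE expr0n/= mul0e adde0.
  apply: (lebesgue_int_scale_le _ _ (b *: y0)) => // x; rewrite lee_fin.
  have := KLM_le x y0; rewrite (distE_mem E L)// min_l//; by case/andP: (bnd K x K0).
apply: (lebesgue_int_superadd _ _ _ (expR (- u 0)) (fun x => expR (- u (distE E K x)))
  (fun x => expR (- u (distE E L x))) (fun x => expR (- u (distE E M x))) x0 y0) => //.
- by move=> x; exact: bnd.
- by move=> x; exact: bnd.
- by rewrite distE_mem.
- by rewrite distE_mem.
Qed.
End Wills.

(** * Scalar inequalities and the choice of [mu] *)

Section PowerMeans.
Context {R : realType}.
Implicit Types (s t x y z p lam mu : R).

Lemma exprDn_le_pow2 n s t : 0 <= s -> 0 <= t ->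
  (s + t) ^+ n.+1 <= 2 ^+ n * (s ^+ n.+1 + t ^+ n.+1).
Proof.
move=> s0 t0; elim: n => [|n IH]; first by rewrite !expr1 expr0 mul1r.
rewrite exprSr (le_trans (ler_wpM2r (addr_ge0 s0 t0) IH))//.
rewrite (exprSr 2) -!mulrA ler_wpM2l ?exprn_ge0//.
rewrite (exprSr _ n.+1) (exprSr t n.+1).
(* Powers are ordered like their bases; expanding this product bounds the mixed terms by the pure
   powers. *)
have : 0 <= (s ^+ n.+1 - t ^+ n.+1) * (s - t).
  have [st|/ltW ts] := leP s t.
    by rewrite mulr_le0 ?subr_le0// lerXn2r.
  by rewrite mulr_ge0 ?subr_ge0// lerXn2r.
nra.
Qed.

Lemma pow2_le_fact n : (2 ^ n <= n.+1`!)%N.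
Proof. by elim: n => // n IH; rewrite expnS factS leq_mul. Qed.

(* The coefficients in [lp_sum p (lp_scale p (1 - lam) K) (lp_scale p lam L)]: [L] has
   the factor [lp_coef p lam mu], and [K] the factor [lp_coef p (1 - lam) (1 - mu)]. *)
Definition lp_coef p lam mu := mu `^ (conj_exp p)^-1 * lam `^ p^-1.

Lemma conj_exp_inv p : 1 < p -> (conj_exp p)^-1 = 1 - p^-1.
Proof. by move=> p1; rewrite /conj_exp; field; lra. Qed.

Lemma lp_coef_ge0 p lam mu : 0 <= lp_coef p lam mu.
Proof. by rewrite mulr_ge0// powR_ge0. Qed.

(** Young's inequality bounds each coefficient by [mu / q + lam / p] (with complements for the
    first); the bounds add up to [1 / q + 1 / p = 1]. *)
Lemma lp_coef_sum_le1 p lam mu : 1 < p -> 0 <= lam <= 1 -> 0 <= mu <= 1 ->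
  lp_coef p (1 - lam) (1 - mu) + lp_coef p lam mu <= 1.
Proof.
move=> p1 /andP[l0 l1] /andP[m0 m1].
have q0 : 0 < conj_exp p by rewrite /conj_exp divr_gt0; lra.
have young a b : 0 <= a -> 0 <= b -> lp_coef p a b <= b / conj_exp p + a / p.
  move=> a0 b0; rewrite /lp_coef.
  have := @conjugate_powR R (b `^ (conj_exp p)^-1) (a `^ p^-1) (conj_exp p) p.
  rewrite -!powRrM !mulVf ?gt_eqF ?powRr1//; last by lra.
  apply; rewrite ?powR_ge0//; first by lra.
  by rewrite conj_exp_inv// subrK.
have := young (1 - lam) (1 - mu); have := young lam mu.
rewrite !subr_ge0 => /(_ l0 m0) h1 /(_ l1 m1) h2.
apply: le_trans (lerD h2 h1) _.
by rewrite conj_exp_inv// le_eqVlt; apply/orP; left; apply/eqP; ring.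
Qed.

(* [P / Q] is the value of [mu] giving equality in Hoelder's inequality when
   [Q = (1 - lam) A^p + lam B^p] and [P] is the term of [Q] at hand. *)
Lemma lp_coef_optimal p P Q lam A : 1 < p -> 0 <= P -> 0 < Q -> 0 <= lam -> 0 <= A ->
  P = lam * A `^ p -> lp_coef p lam (P / Q) * A = P * Q `^ (p^-1 - 1).
Proof.
move=> p1 P0 Q0 l0 A0 PE.
have p0 : p != 0 by lra.
have -> : lp_coef p lam (P / Q) * A = (P / Q) `^ (1 - p^-1) * P `^ p^-1.
  rewrite /lp_coef conj_exp_inv// -mulrA; congr (_ * _).
  rewrite PE powRM ?powR_ge0//.
  by rewrite -powRrM divff// powRr1.
have Qi : 0 <= Q^-1 by rewrite invr_ge0 ltW.
rewrite powRM// mulrAC -powRD; last first.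
  by rewrite subrK oner_eq0.
rewrite subrK powRr1//; congr (_ * _).
by rewrite -[Q^-1]powR_inv1 ?ltW// -powRrM mulN1r opprB.
Qed.

(** The scalar core: with [D] the left-hand side, the best [mu] gives
    [D^((n+1)/p) <= 2^n z <= (n+1)! z], and raising to the power [p / (n+1)] returns [D]. *)
Lemma pmean_le_fact n p lam x y z : 1 < p -> 0 <= lam <= 1 -> 0 <= x -> 0 <= y -> 0 <= z ->
  (forall mu, 0 <= mu <= 1 ->
    lp_coef p (1 - lam) (1 - mu) ^+ n.+1 * x + lp_coef p lam mu ^+ n.+1 * y <= z) ->
  (1 - lam) * x `^ (p / n.+1%:R) + lam * y `^ (p / n.+1%:R) <=
    (n.+1`!%:R * z) `^ (p / n.+1%:R).
Proof.
move=> p1 /andP[l0 l1] x0 y0 z0 H.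
set r := p / n.+1%:R; set P := (1 - lam) * _; set Q := lam * _.
have n0 : (0 : R) < n.+1%:R by [].
have p0 : 0 < p by lra.
have r0 : 0 < r by exact: divr_gt0.
have P0 : 0 <= P by rewrite mulr_ge0 ?powR_ge0// subr_ge0.
have Q0 : 0 <= Q by rewrite mulr_ge0 ?powR_ge0.
have := addr_ge0 P0 Q0; rewrite le_eqVlt => /predU1P[<-|D0]; first exact: powR_ge0.
set D := P + Q in D0 *.
pose A := x `^ n.+1%:R^-1; pose B := y `^ n.+1%:R^-1.
have An : A ^+ n.+1 = x by rewrite -powR_mulrn ?powR_ge0// -powRrM mulVf ?gt_eqF// powRr1.
have Bn : B ^+ n.+1 = y by rewrite -powR_mulrn ?powR_ge0// -powRrM mulVf ?gt_eqF// powRr1.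
have A0 : 0 <= A by exact: powR_ge0.
have B0 : 0 <= B by exact: powR_ge0.
have Ap : A `^ p = x `^ r by rewrite -powRrM mulrC.
have Bp : B `^ p = y `^ r by rewrite -powRrM mulrC.
(* The equality case of Hoelder's inequality: [mu] is the share of the second term in [D]. *)
have mu01 : 0 <= Q / D <= 1.
  by rewrite divr_ge0 ?(ltW D0)//= ler_pdivrMr// mul1r lerDr.
have muC : 1 - Q / D = P / D by rewrite /D; field; rewrite gt_eqF.
have := H _ mu01; rewrite muC -{1}An -Bn -!exprMn.
rewrite (lp_coef_optimal _ _ _ _ _ p1 P0 D0) ?subr_ge0// ?Ap//.
rewrite (lp_coef_optimal _ _ _ _ _ p1 Q0 D0)// ?Bp//.
set c := D `^ _ => Hz.
have c0 : 0 <= c by exact: powR_ge0.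
have DE : P * c + Q * c = D `^ p^-1.
  rewrite -mulrDl -/D /c -{1}(powRr1 (ltW D0)) -powRD; last by rewrite (gt_eqF D0) implybT.
  by rewrite addrC subrK.
have key : (D `^ p^-1) ^+ n.+1 <= n.+1`!%:R * z.
  have Pc : 0 <= P * c by exact: mulr_ge0.
  have Qc : 0 <= Q * c by exact: mulr_ge0.
  rewrite -DE (le_trans (exprDn_le_pow2 _ _ _ _ _))//.
  apply: ler_pM => //.
    by rewrite addr_ge0// exprn_ge0.
  by rewrite -natrX ler_nat pow2_le_fact.
have -> : D = ((D `^ p^-1) ^+ n.+1) `^ r.
  rewrite -powR_mulrn ?powR_ge0// -!powRrM.
  by rewrite (_ : p^-1 * _ = 1) ?powRr1 ?ltW//; rewrite /r; field; rewrite !gt_eqF.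
by apply: ge0_ler_powR; rewrite ?nnegrE ?exprn_ge0 ?powR_ge0 ?mulr_ge0// ltW.
Qed.
End PowerMeans.

(** * Application to the L_p combination *)

Lemma lp_sum_mem (R : realType) n (K L : set 'rV[R]_n) (p lam mu : R) x y :
  0 <= mu <= 1 -> K x -> L y ->
  lp_sum p (lp_scale p (1 - lam) K) (lp_scale p lam L)
    (lp_coef p (1 - lam) (1 - mu) *: x + lp_coef p lam mu *: y).
Proof.
move=> /andP[m0 m1] Kx Ly.
exists ((1 - lam) `^ p^-1 *: x), (lam `^ p^-1 *: y), mu; split => //.
- by exists x.
- by exists y.
- by rewrite !scalerA.
Qed.

Theorem mainTheorem13 (R : realType) (n : nat) (K L E : set 'rV[R]_n)
  (u : R -> R) (p lam : R) :
  (0 < n)%N ->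
  convex_body K -> convex_body L -> convex_body E ->
  interior E 0 ->
  (forall s t : R, 0 <= s -> s < t -> u s < u t) ->
  1 < p ->
  0 < lam -> lam < 1 ->
  ((wills u (lp_sum p (lp_scale p (1 - lam) K) (lp_scale p lam L)) E)
      `^ (p / n%:R) >=
   ((n`!%:R `^ (p / n%:R))^-1)%:E *
     ((1 - lam)%:E * (wills u K E) `^ (p / n%:R)
      + lam%:E * (wills u L E) `^ (p / n%:R)))%E.
Proof.
case: n K L E => // n K L E _ [K0 _] [L0 _] [_ [_ cE]] E0 u_incr p1 l0 l1.
set M := lp_sum _ _ _; set r := p / _.
have r0 : 0 < r by rewrite divr_gt0//; lra.
have super mu : 0 <= mu <= 1 ->
    ((lp_coef p (1 - lam) (1 - mu) ^+ n.+1)%:E * wills u K E +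
     (lp_coef p lam mu ^+ n.+1)%:E * wills u L E <= wills u M E)%E.
  move=> mu01; apply: wills_superadd => //; rewrite ?lp_coef_ge0//.
    by apply: lp_coef_sum_le1 => //; rewrite !ltW.
  by move=> x y Kx Ly; exact: lp_sum_mem.
have := wills_ge0 u _ M E; have := wills_ge0 u _ L E; have := wills_ge0 u _ K E.
move: super; move: (wills u K E) (wills u L E) (wills u M E) => WK WL WM super WK0 WL0 WM0.
have [WMy|WMy] := eqVneq WM +oo%E.
  by rewrite WMy poweRyr ?gt_eqF// leey.
(* At [mu = 1/2] both coefficients are positive, so finiteness of [WM] forces that of [WK] and [WL],
   and the claim reduces to real numbers. *)
have half : 0 <= (2^-1 : R) <= 1 by lra.
have halfgt (a : R) : 0 < a -> (0 < (lp_coef p a 2^-1 ^+ n.+1)%:E)%E.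
  by move=> a0; rewrite lte_fin exprn_gt0// mulr_gt0// powR_gt0.
have halfE : 1 - 2^-1 = 2^-1 :> R by lra.
have WKf : WK \is a fin_num.
  rewrite ge0_fin_numE// ltey; apply: contra WMy => /eqP WKy.
  have := super _ half; rewrite WKy halfE gt0_muley ?halfgt ?subr_gt0//.
  rewrite addye ?leye_eq// gt_eqF// (lt_le_trans ltNy0)// mule_ge0//.
  by rewrite ltW// halfgt.
have WLf : WL \is a fin_num.
  rewrite ge0_fin_numE// ltey; apply: contra WMy => /eqP WLy.
  have := super _ half; rewrite WLy halfE (gt0_muley (halfgt lam _))//.
  rewrite addey ?leye_eq// gt_eqF// (lt_le_trans ltNy0)// mule_ge0//.
  by rewrite ltW// halfgt// subr_gt0.
have WMf : WM \is a fin_num by rewrite ge0_fin_numE// ltey.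
move: WK0 WL0 WM0 super WKf WLf WMf {WMy}.
case: WK => // x; case: WL => // y; case: WM => // z.
rewrite !lee_fin => x0 y0 z0 super _ _ _.
have f0 : 0 < (n.+1`!%:R : R) `^ r by rewrite powR_gt0// ltr0n fact_gt0.
rewrite ler_pdivrMl// -powRM ?ler0n//.
by apply: pmean_le_fact => //; rewrite !ltW.
Qed.
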